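(* Let $n\ge 2$, $K=(n^2-n)/2$, $0<p\le 1/2$, $q=1-p$, $\epsilon>0$ and $r=1+\epsilon$, and assume $rp\le 1$. Let $\mathbf{D}$ be a random directed graph on $\{1,\dots,n\}$ in which each of the $n(n-1)$ possible arcs $(i,j)$, $i\ne j$, is present independently with probability $p$; let $\mathbf{X}$ be the number of arcs $(i,j)$ with $j>i$ and $\mathbf{Y}$ the number of arcs $(i,j)$ with $i>j$ (so $\mathbf{X},\mathbf{Y}$ are independent with binomial distribution $B(K,p)$). Then, with $h(u)=(1+u)\log(1+u)-u$, $$\Pr(\mathbf{X}-r\mathbf{Y}\ge 0)\le \exp\left(-(1+r^2)Kpq\,h\left(\frac{\epsilon}{(1+r^2)q}\right)\right),$$ and consequently, as $\epsilon\to 0$, $$\Pr(\mathbf{X}-r\mathbf{Y}\ge 0)\le \exp\left(-\frac{Kp\epsilon^2}{2(1+r^2)q}\bigl(1+O(\epsilon)\bigr)\right).$$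
   Context: Here $\log$ is the natural logarithm, and $O(\epsilon)$ denotes a quantity bounded in absolute value by a constant times $\epsilon$ for small $\epsilon$. *)

(* Defs.v *)
From HB Require Import structures.
From mathcomp Require Import all_boot all_order all_algebra.
From mathcomp Require Import all_classical all_reals all_analysis.

Set Implicit Arguments.
Unset Strict Implicit.
Unset Printing Implicit Defensive.

Import Order.TTheory GRing.Theory Num.Theory.
Import numFieldNormedType.Exports.

Local Open Scope classical_set_scope.
Local Open Scope ring_scope.

Definition mutually_independent (R : realType) (d : measure_display)
    (T : measurableType d) (P : probability T R) (I : finType)
    (A : {set I}) (E : I -> set T) : Prop :=
  forall S : {set I}, S \subset A ->
    P (\bigcap_(i in [set` S]) E i) = (\prod_(i in S) P (E i))%E.

(* A directed graph on n labelled vertices is the set of its arcs; the vertices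
   1, ..., n are represented by 0, ..., n - 1. *)
Definition possible_arcs (n : nat) : {set 'I_n * 'I_n} :=
  [set a : 'I_n * 'I_n | a.1 != a.2]%SET.

Definition forward_arcs (n : nat) (G : {set 'I_n * 'I_n}) : nat :=
  #|[set a in G | (a.1 < a.2)%N]%SET|.

Definition backward_arcs (n : nat) (G : {set 'I_n * 'I_n}) : nat :=
  #|[set a in G | (a.2 < a.1)%N]%SET|.

Definition random_digraph (R : realType) (d : measure_display)
    (T : measurableType d) (P : probability T R) (n : nat) (p : R)
    (D : T -> {set 'I_n * 'I_n}) : Prop :=
  let present (a : 'I_n * 'I_n) : set T := [set t | a \in D t] in
  [/\ forall t, D t \subset possible_arcs n,
      forall a, a \in possible_arcs n ->
        measurable (present a) /\ P (present a) = p%:E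
    & mutually_independent P (possible_arcs n) present].

Definition bennett (R : realType) (u : R) : R := (1 + u) * ln (1 + u) - u.

(* Main.v *)
(** Bennett's inequality, applied to the independent centred variables
    [1_{(i,j) in D} - p] for [i < j] and [- r (1_{(i,j) in D} - p)] for [i > j]:
    each is at most [1] because [r p <= 1], the variances add up to
    [(1 + r^2) K p q], and [X - r Y >= 0] means that the sum is at least
    [K p eps].  The asymptotic form follows from [h u >= u^2 / 2 * (1 - u)] and
    [u = eps / ((1 + r^2) q) <= eps], uniformly in [n] and [p].

    Independence is only known for the events that a given set of arcs is
    present.  This suffices for the moment generating function, since
    [expR (l c_a 1_{E_a}) = 1 + (expR (l c_a) - 1) 1_{E_a}] and the product over
    [a] expands into a combination of indicators of such intersections. *)

Require Import Defs.
From HB Require Import structures.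
From mathcomp Require Import all_boot all_order all_algebra.
From mathcomp Require Import all_classical all_reals all_analysis.
From mathcomp Require Import measurable_realfun ring lra.

Set Implicit Arguments.
Unset Strict Implicit.
Unset Printing Implicit Defensive.

Import Order.TTheory GRing.Theory Num.Theory.
Import numFieldNormedType.Exports.

Local Open Scope classical_set_scope.
Local Open Scope ring_scope.

(** * Calculus inequalities for the exponential, the logarithm and [bennett] *)

Lemma ge0_derive_ge0 (R : realType) (f f' : R -> R) :
  (forall x : R, 0 <= x -> is_derive x 1 f (f' x)) -> f 0 = 0 ->
  (forall x : R, 0 <= x -> 0 <= f' x) ->
  forall x : R, 0 <= x -> 0 <= f x.
Proof.
move=> df f0 f'ge0 x x0.
have df_itv y : y \in `]0, x[%R -> is_derive y 1 f (f' y).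
  by rewrite in_itv/= => /andP[/ltW y0 _]; exact: df.
have cf : {within `[0, x], continuous f}.
  apply: derivable_within_continuous => y.
  by rewrite in_itv/= => /andP[y0 _]; have [] := df _ y0.
have [c] := MVT_segment x0 df_itv cf.
rewrite in_itv/= => /andP[c0 _]; rewrite f0 !subr0 => ->.
by rewrite mulr_ge0 // f'ge0.
Qed.

(* The difference of the two sides and its derivative in [l] vanish at [0], and
   its second derivative is [s ^+ 2 * (expR l - expR (s * l))], nonnegative. *)
Lemma expR_sub1_sub_le (R : realType) (s l : R) : s <= 1 -> 0 <= l ->
  expR (s * l) <= 1 + s * l + s ^+ 2 * (expR l - 1 - l).
Proof.
move=> s1 l0; rewrite -subr_ge0.
pose f' x := s ^+ 2 * (expR x - 1) - s * (expR (s * x) - 1).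
pose f x := 1 + s * x + s ^+ 2 * (expR x - 1 - x) - expR (s * x).
have dexps (x : R) : is_derive x 1 (fun x : R => expR (s * x)) (s * expR (s * x)).
  have ds : is_derive x 1 (fun x : R => s * x) s.
    by apply: is_derive_eq; rewrite /GRing.scale/= mulr1.
  have := @is_derive1_comp R expR (fun x : R => s * x) x _ _ (is_derive_expR _) ds.
  by rewrite mulrC.
apply: (@ge0_derive_ge0 R f f' _ _ _ l l0).
- by move=> x _; apply: is_derive_eq; rewrite /f' /GRing.scale/=; ring.
- by rewrite /f mulr0 expR0; ring.
move=> y y0; apply: (@ge0_derive_ge0 R f'
  (fun x => s ^+ 2 * expR x - s * (s * expR (s * x))) _ _ _ y y0).
- by move=> x _; apply: is_derive_eq; rewrite /GRing.scale/=; ring.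
- by rewrite /f' mulr0 expR0; ring.
move=> x x0; rewrite mulrA -expr2 -mulrBr mulr_ge0 ?sqr_ge0// subr_ge0 ler_expR.
by rewrite -[leRHS]mul1r ler_wpM2r.
Qed.

(** Factor out the mean [expR (l * (c * p))]. The centred variable takes the values [c * (1 - p)]
    and [- (c * p)], both at most 1, so [expR_sub1_sub_le] applies to each; in the average the
    linear terms cancel and the squares add up to the variance. Then use [1 + x <= expR x]. *)
Lemma bernoulli_mgf_le (R : realType) (p c l : R) : 0 <= p <= 1 ->
  c * (1 - p) <= 1 -> - (c * p) <= 1 -> 0 <= l ->
  1 + p * (expR (l * c) - 1)
  <= expR (l * (c * p) + c ^+ 2 * p * (1 - p) * (expR l - 1 - l)).
Proof.
move=> /andP[p0 p1] c1 c2 l0.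
have up := expR_sub1_sub_le c1 l0; have down := expR_sub1_sub_le c2 l0.
set g := expR l - 1 - l in up down *.
rewrite expRD.
have -> : 1 + p * (expR (l * c) - 1) = expR (l * (c * p)) *
    (p * expR (c * (1 - p) * l) + (1 - p) * expR (- (c * p) * l)).
  rewrite [RHS]mulrDr [X in _ = X + _]mulrCA -expRD [X in _ = _ + X]mulrCA -expRD.
  have -> : l * (c * p) + c * (1 - p) * l = l * c by ring.
  have -> : l * (c * p) + - (c * p) * l = 0 by ring.
  by rewrite expR0; ring.
rewrite ler_pM2l ?expR_gt0//; apply: le_trans (expR_ge1Dx _).
have -> : 1 + c ^+ 2 * p * (1 - p) * g =
    p * (1 + c * (1 - p) * l + (c * (1 - p)) ^+ 2 * g)
  + (1 - p) * (1 + - (c * p) * l + (- (c * p)) ^+ 2 * g) by ring.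
by apply: lerD; rewrite ler_wpM2l// subr_ge0.
Qed.

(** Applying [ln (1 + x) <= x] to [x = (1 + u)^-1 - 1] gives [ln (1 + u) >= u / (1 + u)], and
    [(u - u ^+ 2) * (1 + u) = u - u ^+ 3 <= u]. *)
Lemma ln1D_ge (R : realType) (u : R) : 0 <= u -> u - u ^+ 2 <= ln (1 + u).
Proof.
move=> u0; have u1 : 0 < 1 + u by rewrite ltr_wpDr.
have : ln (1 + ((1 + u)^-1 - 1)) <= (1 + u)^-1 - 1.
  by rewrite le_ln1Dx// ltrBrDr addNr invr_gt0.
rewrite addrCA subrr addr0 lnV ?posrE// => h.
have : u - u ^+ 2 <= 1 - (1 + u)^-1.
  have -> : 1 - (1 + u)^-1 = u / (1 + u) by field; rewrite gt_eqF.
  rewrite ler_pdivlMr//; have : 0 <= u ^+ 3 by rewrite exprn_ge0.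
  by lra.
by lra.
Qed.

(** The difference vanishes at 0, and by [ln1D_ge] its derivative is at least [x ^+ 2 / 2]. *)
Lemma bennett_ge (R : realType) (u : R) : 0 <= u ->
  u ^+ 2 / 2 * (1 - u) <= bennett u.
Proof.
move=> u0; rewrite -subr_ge0.
apply: (@ge0_derive_ge0 R (fun x => bennett x - x ^+ 2 / 2 * (1 - x))
  (fun x => ln (1 + x) - x + 3 / 2 * x ^+ 2) _ _ _ u u0).
- move=> x x0; have x1 : 0 < 1 + x by rewrite ltr_wpDr.
  have dln : is_derive x 1 (fun x : R => ln (1 + x)) (1 + x)^-1.
    have d1 : is_derive x 1 (fun x : R => 1 + x) 1.
      by apply: is_derive_eq; rewrite add0r mulr1.
    have := @is_derive1_comp R (@ln R) (fun x : R => 1 + x) x _ _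
      (is_derive1_ln x1) d1.
    by rewrite mulr1.
  rewrite /bennett; apply: is_derive_eq; rewrite /GRing.scale/=.
  by field; rewrite gt_eqF.
- by rewrite /bennett addr0 ln1; ring.
move=> x x0; have := ln1D_ge x0; have := sqr_ge0 x; by lra.
Qed.

(** * Exponential moments under independence, and Bennett's inequality *)

Lemma prod_add1 (R : comPzSemiRingType) (I : finType) (A : {set I})
    (F : I -> R) :
  \prod_(i in A) (1 + F i) = \sum_(S : {set I} | S \subset A) \prod_(i in S) F i.
Proof.
rewrite big_mkcond/= [RHS]big_mkcond/=.
(* Off [A] the factor 1 is written [0 + 1], so that [bigA_distr] expands over all subsets; those not
   inside [A] contribute a zero factor. *)
rewrite (eq_bigr (fun i => (if i \in A then F i else 0) + 1)); last first.
  by move=> i _; case: ifP; rewrite ?add0r// addrC.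
rewrite bigA_distr; apply: eq_bigr => S _.
rewrite -big_mkcond/=; case: ifPn => [/fintype.subsetP SA|/subsetPn[i iS iA]].
  by apply: eq_bigr => i /SA ->.
by rewrite (bigD1 i)//= (negbTE iA) mul0r.
Qed.

Lemma integral_prod_indep (R : realType) (d : measure_display)
    (T : measurableType d) (P : probability T R) (I : finType) (A : {set I})
    (E : I -> set T) (p F : I -> R) :
  (forall i, i \in A -> measurable (E i) /\ P (E i) = (p i)%:E) ->
  mutually_independent P A E ->
  (\int[P]_t (\prod_(i in A) (1 + F i * \1_(E i) t))%:E
   = (\prod_(i in A) (1 + F i * p i))%:E)%E.
Proof.
move=> EA indep; rewrite prod_add1.
(* Intersecting with [A] makes [C S] measurable for every [S], as [integral_sum] asks, and changes
   nothing when [S] lies in [A]. *)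
pose C (S : {set I}) := \bigcap_(i in [set` S :&: A]) E i.
have mC S : measurable (C S).
  apply: fin_bigcap_measurable; first exact: finite_finset.
  by move=> i /=; rewrite inE => /andP[_ /EA[]].
have indicC (S : {set I}) t : S \subset A -> \1_(C S) t = \prod_(i in S) \1_(E i) t :> R.
  move=> /finset.setIidPl SA; rewrite indicE /C SA.
  have [tC|tC] := boolP (t \in _).
    rewrite big1// => i iS; rewrite indicE mem_set//.
    by move: tC; rewrite inE; exact.
  case: (pickP [pred i in S | t \notin E i]) => [i /andP[iS tE]|tE].
    by rewrite (bigD1 i)//= indicE (negbTE tE) mul0r.
  case/negP: tC; rewrite inE => i/= iS.
  by have := tE i; rewrite /= iS/= => /negbFE; rewrite inE.
under eq_integral => t _.
  rewrite prod_add1 -sumEFin.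
  under eq_bigr => S SA do
    rewrite big_split/= -(indicC _ _ SA) EFinM.
  over.
rewrite integral_sum//; last first.
  move=> S; apply: integrableZl => //; exact: integrable_indic.
rewrite -sumEFin; apply: eq_bigr => S SA.
rewrite integralZl//; last exact: integrable_indic.
rewrite integral_indic// setIT big_split/= EFinM; congr (_ * _)%E.
rewrite /C (finset.setIidPl SA) indep// -prodEFin; apply: eq_bigr => i iS.
by have [|_ ->] := EA i; rewrite ?(fintype.subsetP SA).
Qed.

Lemma measurable_weighted_sum (R : realType) (d : measure_display)
    (T : measurableType d) (I : finType) (A : {set I}) (E : I -> set T)
    (c : I -> R) :
  (forall i, i \in A -> measurable (E i)) ->
  measurable_fun [set: T] (fun t => \sum_(i in A) c i * \1_(E i) t).
Proof.
move=> mE.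
rewrite (_ : (fun t => _) =
    fun t => \sum_i (if i \in A then c i * \1_(E i) t else 0)); last first.
  by apply/funext => t; rewrite big_mkcond.
apply: measurable_sum => i; have [/mE mEi|_] := boolP (i \in A); last exact: measurable_cst.
by apply: measurable_funM; [exact: measurable_cst|exact: measurable_indic].
Qed.

Lemma bennett_inequality (R : realType) (d : measure_display)
    (T : measurableType d) (P : probability T R) (I : finType) (A : {set I})
    (E : I -> set T) (p : R) (c : I -> R) (u : R) :
  (forall i, i \in A -> measurable (E i) /\ P (E i) = p%:E) ->
  mutually_independent P A E ->
  0 <= p <= 1 ->
  (forall i, i \in A -> c i * (1 - p) <= 1 /\ - (c i * p) <= 1) ->
  0 <= u ->
  (P [set t | (\sum_(i in A) c i * p
               + (\sum_(i in A) c i ^+ 2 * p * (1 - p)) * u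
               <= \sum_(i in A) c i * \1_(E i) t)%R]
   <= (expR (- ((\sum_(i in A) c i ^+ 2 * p * (1 - p)) * bennett u)))%:E)%E.
Proof.
move=> EA indep p01 cA u0.
set v := \sum_(i in A) c i ^+ 2 * p * (1 - p).
set s := _ + _; set Z := fun t => \sum_(i in A) c i * \1_(E i) t.
have mZ : measurable_fun [set: T] Z.
  by apply: measurable_weighted_sum => i /EA[].
set Ev := [set t | _].
have mEv : measurable Ev.
  rewrite (_ : Ev = Z @^-1` `[s, +oo[); last first.
    by apply/seteqP; split => t; rewrite /= in_itv/= andbT.
  by rewrite -[_ @^-1` _]setTI; exact: mZ.
have u1 : 0 < 1 + u by rewrite ltr_wpDr.
(* This [l] minimises the Chernoff exponent [v * (expR l - 1 - l) - l * (v * u)], with minimum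
   [- (v * bennett u)]. *)
pose l := ln (1 + u).
have l0 : 0 <= l by rewrite ln_ge0// lerDl.
pose F i := expR (l * c i) - 1.
have expZ t : expR (l * Z t) = \prod_(i in A) (1 + F i * \1_(E i) t).
  rewrite mulr_sumr expR_sum; apply: eq_bigr => i _; rewrite indicE /F.
  by case: (_ \in _); rewrite ?mulr1 ?mulr0 ?addr0 ?expR0// addrC subrK.
have -> : P Ev = (\int[P]_t (\1_Ev t)%:E)%E by rewrite integral_indic// setIT.
(* Markov's inequality: the indicator of [Ev] is at most [expR (l * (Z t - s))]. *)
apply: (@le_trans _ _ (\int[P]_t (expR (- (l * s)) * expR (l * Z t))%:E)%E).
  apply: ge0_le_integral => //.
  - by apply/measurable_EFinP; exact: measurable_indic.
  - apply/measurable_EFinP; apply: measurable_funM => //.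
    apply: (measurableT_comp (@measurable_expR R)).
    by apply: measurable_funM => //; exact: measurable_cst.
  - move=> t _; rewrite lee_fin indicE -expRD.
    have [|_] := boolP (t \in Ev); last exact: expR_ge0.
    rewrite inE /Ev/= => sZ; rewrite -[leLHS]expR0 ler_expR addrC subr_ge0.
    by rewrite ler_wpM2l.
under eq_integral => t _ do rewrite EFinM.
rewrite ge0_integralZl//; last first.
  apply/measurable_EFinP; apply: (measurableT_comp (@measurable_expR R)).
  by apply: measurable_funM => //; exact: measurable_cst.
under eq_integral => t _ do rewrite expZ.
rewrite (integral_prod_indep F EA indep) -EFinM lee_fin.
apply: (@le_trans _ _ (expR (- (l * s)) * \prod_(i in A)
    expR (l * (c i * p) + c i ^+ 2 * p * (1 - p) * (expR l - 1 - l)))).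
  rewrite ler_wpM2l ?expR_ge0//; apply: ler_prod => i iA.
  have [c1 c2] := cA i iA; rewrite [F i * p]mulrC bernoulli_mgf_le// andbT.
  have /andP[p0 p1] := p01.
  have := expR_ge0 (l * c i); rewrite /F; nra.
(* The means in the exponent cancel the mean part of [s], which leaves the minimum above. *)
rewrite -expR_sum -expRD ler_expR big_split/= -mulr_sumr -[X in _ + (_ + X)]mulr_suml -/v.
by rewrite /s /bennett lnK ?posrE// -/l le_eqVlt; apply/orP; left; apply/eqP; ring.
Qed.

(** * Arc counts, and Bennett's inequality for the random digraph *)

Lemma card_possible_arcs (n : nat) : (#|possible_arcs n| + n = n * n)%N.
Proof.
have diag : #|~: possible_arcs n| = n.
  rewrite -[RHS](card_ord n) -cardsT -(card_imset _ (f := fun i : 'I_n => (i, i))).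
    apply: eq_card => -[i j]; rewrite !inE negbK /=.
    by apply/eqP/imsetP => [->|[k _ [-> ->]]//]; exists j.
  by move=> i j [].
by rewrite -[X in (_ + X)%N]diag cardsC card_prod card_ord.
Qed.

Lemma backward_arcs_possible (n : nat) :
  backward_arcs (possible_arcs n) = forward_arcs (possible_arcs n).
Proof.
have swap_inj : injective (fun a : 'I_n * 'I_n => (a.2, a.1)).
  by move=> [i j] [k l] [-> ->].
rewrite /forward_arcs -(card_imset _ swap_inj); apply: eq_card => -[i j].
rewrite !inE/=; apply/andP/imsetP => [[ij ji]|[[k l]]].
  by exists (j, i) => //; rewrite !inE/= eq_sym ij ji.
by rewrite !inE/= => /andP[kl lk] [-> ->]; rewrite eq_sym.
Qed.

(** Forward and backward arcs partition the [n * n - n] possible ones, and reversal makes the two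
    classes equally large. *)
Lemma forward_arcs_possible (R : realType) (n : nat) :
  (forward_arcs (possible_arcs n))%:R = (n%:R ^+ 2 - n%:R) / 2 :> R.
Proof.
have : (forward_arcs (possible_arcs n) + backward_arcs (possible_arcs n)
        = #|possible_arcs n|)%N.
  rewrite -(cardsID [set a : 'I_n * 'I_n | (a.1 < a.2)%N]%SET).
  congr (_ + _)%N; apply: eq_card => -[i j]; rewrite !inE//=.
  by rewrite -val_eqE/=; case: ltngtP.
rewrite backward_arcs_possible => h; have := card_possible_arcs n.
by rewrite -h => /(congr1 (fun m => m%:R : R)); rewrite !natrD natrM; lra.
Qed.

Lemma natr_card_setIdE (R : pzSemiRingType) (I : finType) (G A : {set I})
    (Q : pred I) :
  G \subset A ->
  #|[set i in G | Q i]%SET|%:R = \sum_(i in A) (Q i)%:R * (i \in G)%:R :> R.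
Proof.
move=> /fintype.subsetP GA; rewrite -sum1_card natr_sum big_mkcond [RHS]big_mkcond/=.
apply: eq_bigr => i _; rewrite inE; have [/GA ->|_] := boolP (i \in G).
  by rewrite mulr1; case: (Q i).
by rewrite mulr0; case: ifP.
Qed.

Lemma random_digraph_bennett (R : realType) (n : nat) (p eps : R)
    (d : measure_display) (T : measurableType d) (P : probability T R)
    (D : T -> {set 'I_n * 'I_n}) :
  let K := (n%:R ^+ 2 - n%:R) / 2 in
  let q := 1 - p in
  let r := 1 + eps in
  0 < p < 1 -> 0 < eps -> r * p <= 1 -> random_digraph P p D ->
  (P [set t | (0 <= (forward_arcs (D t))%:R - r * (backward_arcs (D t))%:R)%R]
   <= (expR (- ((1 + r ^+ 2) * K * p * q
                * bennett (eps / ((1 + r ^+ 2) * q)))))%:E)%E.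
Proof.
move=> K q r /andP[p0 p1] eps0 rp1 [DA PD indep].
pose fw (a : 'I_n * 'I_n) := (a.1 < a.2)%N.
pose bw (a : 'I_n * 'I_n) := (a.2 < a.1)%N.
(* Weight 1 on forward arcs and [- r] on backward ones, so that the weighted sum of presence
   indicators is X - rY. *)
pose c a : R := (fw a)%:R - r * (bw a)%:R.
pose u := eps / ((1 + r ^+ 2) * q).
have q0 : 0 < q by rewrite subr_gt0.
have r0 : 0 < r by rewrite addr_gt0.
have r21 : 0 < 1 + r ^+ 2 by rewrite ltr_pwDl// sqr_ge0.
have u0 : 0 <= u by rewrite divr_ge0 ?mulr_ge0 ?ltW.
have fw_bw a : ~~ (fw a && bw a) by rewrite /fw /bw; case: ltngtP.
(* The binding case is an absent backward arc, whose centred value is [r * p]. *)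
have cA a : a \in possible_arcs n -> c a * (1 - p) <= 1 /\ - (c a * p) <= 1.
  move=> _; have : 0 <= r * p by rewrite mulr_ge0 ?ltW.
  have : 0 <= r * q by rewrite mulr_ge0 ?ltW.
  have := fw_bw a; rewrite /c /q.
  by case: (fw a) (bw a) => -[]//= _; rewrite /= ?mulr0 ?mulr1 ?subr0; split; lra.
have p01 : 0 <= p <= 1 by rewrite !ltW.
have sumc (G : {set 'I_n * 'I_n}) : G \subset possible_arcs n ->
    \sum_(a in possible_arcs n) c a * (a \in G)%:R
    = (forward_arcs G)%:R - r * (backward_arcs G)%:R.
  move=> GA; rewrite (natr_card_setIdE R fw GA) (natr_card_setIdE R bw GA).
  by rewrite mulr_sumr -sumrB; apply: eq_bigr => a _; rewrite /c; ring.
have sumw (x y : R) :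
    \sum_(a in possible_arcs n) (x * (fw a)%:R + y * (bw a)%:R) = x * K + y * K.
  rewrite big_split/= -!mulr_sumr /K -forward_arcs_possible.
  rewrite -[X in _ = _ + y * X%:R]backward_arcs_possible.
  rewrite (natr_card_setIdE R fw (subxx _)) (natr_card_setIdE R bw (subxx _)).
  by congr (_ * _ + _ * _); apply: eq_bigr => a ->; rewrite mulr1.
have := bennett_inequality PD indep p01 cA u0.
set v := \sum_(a in _) c a ^+ 2 * p * (1 - p).
have vE : v = (1 + r ^+ 2) * K * p * q.
  rewrite /v (eq_bigr (fun a => p * q * (fw a)%:R + r ^+ 2 * p * q * (bw a)%:R)).
    by rewrite sumw; ring.
  move=> a _; have := fw_bw a; rewrite /c -/q.
  by case: (fw a) (bw a) => -[]//= _; ring.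
(* The choice of [u] puts the threshold at 0: the mean is [- (eps * K * p)] and
   [v * u = eps * K * p]. *)
have -> : \sum_(a in possible_arcs n) c a * p + v * u = 0.
  rewrite (eq_bigr (fun a => p * (fw a)%:R + (- (r * p)) * (bw a)%:R)).
    by rewrite sumw vE /u /r; field; rewrite !gt_eqF.
  by move=> a _; rewrite /c; ring.
rewrite vE; congr (P _ <= _)%E; apply: eq_set => t.
rewrite -sumc//; congr (is_true (0 <= _)); apply: eq_bigr => a _.
by rewrite indicE; congr (_ * (nat_of_bool _)%:R); apply/idP/idP; rewrite inE.
Qed.

Theorem theorem3p2 (R : realType) :
  (forall (n : nat) (K p q eps r : R),
     (2 <= n)%N -> K = (n%:R ^+ 2 - n%:R) / 2 ->
     0 < p -> p <= 1 / 2 -> q = 1 - p ->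
     0 < eps -> r = 1 + eps -> r * p <= 1 ->
   forall (d : measure_display) (T : measurableType d) (P : probability T R)
     (D : T -> {set 'I_n * 'I_n}),
     random_digraph P p D ->
     (P [set t | (0 <= (forward_arcs (D t))%:R - r * (backward_arcs (D t))%:R)%R]
      <= (expR (- ((1 + r ^+ 2) * K * p * q
                   * bennett (eps / ((1 + r ^+ 2) * q)))))%:E)%E)
  /\
  (exists eta : R -> R, eta =O_ (0^'+) (fun eps : R => eps) /\
   forall (n : nat) (K p q eps r : R),
     (2 <= n)%N -> K = (n%:R ^+ 2 - n%:R) / 2 ->
     0 < p -> p <= 1 / 2 -> q = 1 - p ->
     0 < eps -> r = 1 + eps -> r * p <= 1 ->
   forall (d : measure_display) (T : measurableType d) (P : probability T R)
     (D : T -> {set 'I_n * 'I_n}),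
     random_digraph P p D ->
     (P [set t | (0 <= (forward_arcs (D t))%:R - r * (backward_arcs (D t))%:R)%R]
      <= (expR (- (K * p * eps ^+ 2 / (2 * (1 + r ^+ 2) * q)
                   * (1 + eta eps))))%:E)%E).
Proof.
split=> [n K p q eps r _ -> p0 p2 -> eps0 -> rp1 d T P D rD|].
  by apply: random_digraph_bennett => //; lra.
(* [bennett_ge] yields the factor [1 - eps / v] with [v = (1 + r ^+ 2) * q]; since [v >= 1], it is
   at least [1 - eps], whatever [n] and [p]. *)
exists (fun eps => - eps); split.
  apply/eqOP; exists 1; split; first exact: real1.
  move=> k k1; near=> x; rewrite normrN -[leLHS]mul1r ler_wpM2r ?normr_ge0//.
  exact: ltW.
move=> n K p q eps r n2 {K}-> p0 p2 {q}-> eps0 {r}-> rp1 d T P D rD.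
have p01 : 0 < p < 1 by lra.
apply: (le_trans (random_digraph_bennett p01 eps0 rp1 rD)).
rewrite lee_fin ler_expR lerN2.
set k := _ / 2; set r := 1 + eps; set q := 1 - p.
have k0 : 0 <= k by rewrite /k -forward_arcs_possible.
clearbody k.
have q2 : 1 / 2 <= q by rewrite /q; lra.
have q0 : 0 < q by lra.
have r1 : 1 <= r ^+ 2 by rewrite /r; nra.
(* Here [1 + r ^+ 2 >= 2] compensates [q >= 1 / 2]. *)
have v1 : 1 <= (1 + r ^+ 2) * q by nra.
set v := (1 + r ^+ 2) * q in v1 *.
have v0 : 0 < v by lra.
have u0 : 0 <= eps / v by rewrite divr_ge0 ?ltW.
have ueps : eps / v <= eps by rewrite ler_pdivrMr// ler_peMr// ltW.
have -> : k * p * eps ^+ 2 / (2 * (1 + r ^+ 2) * q) * (1 - eps)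
        = (1 + r ^+ 2) * k * p * q * ((eps / v) ^+ 2 / 2 * (1 - eps)).
  by rewrite /v; field; rewrite !gt_eqF//; lra.
rewrite ler_wpM2l//.
  by rewrite !mulr_ge0//; lra.
apply: le_trans (bennett_ge u0).
by rewrite ler_wpM2l ?divr_ge0 ?sqr_ge0// lerD2l lerN2.
Unshelve. all: by end_near.
Qed.
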